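(* Let $D$ be a digraph. If there is a valid sequence $(\mathcal R_n)_{n\in\mathbb N}$ in $D$ that does not concentrate in finitely many ends, then $D$ contains infinitely many pairwise disjoint double rays.
   Context: Digraphs may be infinite; containment is as subdigraphs; disjoint means vertex-disjoint. A dipath is a (finite) directed path. For vertex sets $A,B$, an $A$--$B$ dipath is a dipath that starts at a vertex of $A$, ends at a vertex of $B$ and is internally disjoint from $A\cup B$; for subdigraphs $Q,R$, a $Q$--$R$ dipath is a $V(Q)$--$V(R)$ dipath. A ray is a digraph with precisely one vertex $v$ of out-degree $1$ and in-degree $0$, with a dipath from $v$ to each of its vertices, and all of whose vertices other than $v$ have out-degree $1$ and in-degree $1$. An anti-ray is obtained from a ray by reversing all edges. A double ray is an infinite digraph all of whose vertices have in- and out-degree $1$ and such that for all vertices $v,w$ there exists a $v$--$w$ or a $w$--$v$ dipath. The tails of a double ray $R$ are its subdigraphs that are rays starting at a vertex of $R$ (forward tails) or anti-rays ending at a vertex of $R$ (backward tails). For rays or anti-rays $Q,R$ in a digraph $D$ write $Q\le R$ if there are infinitely many pairwise disjoint $Q$--$R$ dipaths in $D$, and $Q\sim R$ if $Q\le R$ and $R\le Q$. Then $\sim$ is an equivalence relation on the set of all rays and anti-rays in $D$, and its equivalence classes are the ends of $D$. A valid sequence in $D$ is a sequence $(\mathcal R_n)_n$ (indexed by $n\in\mathbb N$, or more generally by all $n\ge N$ for some $N\in\mathbb N$) such that each $\mathcal R_n$ is a set of $n$ pairwise disjoint double rays in $D$. A valid sequence $(\mathcal R_n)_{n\in\mathbb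 N}$ concentrates in finitely many ends if there exist $N,M\in\mathbb N$ and $M$ ends $\epsilon_1,\ldots,\epsilon_M$ of $D$ such that for all $n\in\mathbb N$ and for every double ray $R\in\mathcal R_n$ except for at most $N$ there exists $1\le i\le M$ such that all tails of $R$ lie in $\epsilon_i$. *)

(* Defs.v *)
From mathcomp Require Import all_boot.
From mathcomp Require Import boolp classical_sets functions cardinality.

Set Implicit Arguments.
Unset Strict Implicit.
Unset Printing Implicit Defensive.

Local Open Scope classical_set_scope.
Local Open Scope card_scope.

(* A digraph whose vertices are taken from the ambient type V. A subdigraph of
   D is again a term of type [digraph V], so that rays, dipaths etc. are
   themselves digraphs. *)
Record digraph (V : Type) := Digraph {
  vset : set V;
  edge : V -> V -> Prop;
  edge_vset : forall u v, edge u v -> vset u /\ vset v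
}.

Section Digraphs.
Variable V : Type.
Implicit Types (D G H P Q R T : digraph V) (A B : set V) (u v w : V).
Implicit Types (S e : set (digraph V)) (k n : nat).

Definition subdigraph H G : Prop :=
  vset H `<=` vset G /\ forall u v, edge H u v -> edge G u v.

Definition reverse G : digraph V :=
  @Digraph V (vset G) (fun u v => edge G v u)
    (fun u v uv => let: conj Gv Gu := edge_vset uv in conj Gu Gv).

Definition out_degree_is G v k : Prop := [set w | edge G v w] #= `I_k.
Definition in_degree_is G v k : Prop := [set w | edge G w v] #= `I_k.

(* P is a dipath with distinct vertices f 0 = u, f 1, ..., f n = v; the trivial
   dipath n = 0 is allowed. *)
Definition dipath P u v : Prop :=
  exists n (f : nat -> V),
    [/\ f 0 = u, f n = v,
        (forall i j, i <= n -> j <= n -> f i = f j -> i = j),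
        vset P = [set f i | i in `I_n.+1] &
        forall x y, edge P x y <-> exists2 i, i < n & x = f i /\ y = f i.+1].

Definition set_dipath A B P : Prop :=
  exists u v, [/\ dipath P u v, A u, B v &
    vset P `&` (A `|` B) `<=` [set u; v]].

(* The vertex u is the only one of in-degree 0, by the last clause. *)
Definition ray_from R u : Prop :=
  [/\ vset R u,
      out_degree_is R u 1 /\ in_degree_is R u 0,
      (forall w, vset R w -> exists2 P, subdigraph P R & dipath P u w) &
      forall w, vset R w -> w <> u ->
        out_degree_is R w 1 /\ in_degree_is R w 1].

Definition antiray_to R u : Prop := ray_from (reverse R) u.

Definition ray R : Prop := exists u, ray_from R u.

Definition antiray R : Prop := exists u, antiray_to R u.

Definition double_ray R : Prop :=
  [/\ infinite_set (vset R),
      (forall v, vset R v -> out_degree_is R v 1 /\ in_degree_is R v 1) &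
      forall v w, vset R v -> vset R w ->
        exists2 P, subdigraph P R & dipath P v w \/ dipath P w v].

Definition tail R T : Prop :=
  subdigraph T R /\ exists2 u, vset R u & ray_from T u \/ antiray_to T u.

Definition pairwise_disjoint S : Prop := trivIset S (@vset V).

Definition end_le D Q R : Prop :=
  exists S, [/\ infinite_set S, pairwise_disjoint S &
    forall P, S P -> subdigraph P D /\ set_dipath (vset Q) (vset R) P].

Definition end_equiv D Q R : Prop := end_le D Q R /\ end_le D R Q.

Definition rays_and_antirays D : set (digraph V) :=
  [set R | subdigraph R D /\ (ray R \/ antiray R)].

Definition is_end D e : Prop :=
  exists2 R, rays_and_antirays D R &
    e = [set Q | rays_and_antirays D Q /\ end_equiv D Q R].

Definition disjoint_double_rays D S : Prop :=
  (forall R, S R -> subdigraph R D /\ double_ray R) /\ pairwise_disjoint S.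

Definition valid_sequence D (RR : nat -> set (digraph V)) : Prop :=
  forall n, RR n #= `I_n /\ disjoint_double_rays D (RR n).

Definition concentrates_in_finitely_many_ends D
    (RR : nat -> set (digraph V)) : Prop :=
  exists (N M : nat) (eps : 'I_M -> set (digraph V)),
    (forall i, is_end D (eps i)) /\
    forall n,
      [set R | RR n R /\ ~ exists i, forall T, tail R T -> eps i T] #<= `I_N.

End Digraphs.

(* Main.v *)
Require Import Defs.
From mathcomp Require Import all_boot.
From mathcomp Require Import order ssralg ssrnum ssrint.
From mathcomp Require Import boolp classical_sets functions cardinality filter.
From mathcomp Require Import zify.

(* Call a property of double rays fat if the numbers of members of the [RR n]
   having it are unbounded. Non-concentration gives an ultrafilter of fat
   properties none of which is "all tails lie in the end e". A vertex set is hit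
   if almost every double ray meets it.
   If A and B are hit and no dipath leads from A to B off some finite X, let Z be
   the set of vertices reachable from A off X: almost every double ray starts
   outside Z and enters Z exactly once, so that forward parts and backward parts
   can be rerouted separately. Otherwise all hit rays and anti-rays lie in one
   end, and since almost no double ray has all its tails there, almost all
   forward parts, or almost all backward parts, are not hit; those are kept and
   only the other side is rerouted.
   In both cases k disjoint double rays can be turned into k + 1 while fixing any
   given finite segments, and the infinite family is obtained as a limit. *)

Set Implicit Arguments.
Unset Strict Implicit.
Unset Printing Implicit Defensive.

Local Open Scope classical_set_scope.
Local Open Scope card_scope.

(** * Families of disjoint rays and double rays *)

Section Families.
Variables (V : Type) (E : V -> V -> Prop).
Local Open Scope ring_scope.

(** Injectivity in both indices jointly says that each ray has distinct vertices and that different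
    rays are disjoint. The edge relation is a bare [E], so that it can be reversed. *)
Definition disjoint_rays (I : Type) (q : I -> nat -> V) : Prop :=
  (forall i j i' j', q i j = q i' j' -> i = i' /\ j = j') /\
  forall i j, E (q i j) (q i j.+1).

Definition disjoint_lines (I : Type) (s : I -> int -> V) : Prop :=
  (forall i j i' j', s i j = s i' j' -> i = i' /\ j = j') /\
  forall i j, E (s i j) (s i (j + 1)).

End Families.

(** * Rerouting finitely many rays through a family of disjoint lines *)

Section Reroute.
Variables (V : Type) (E : V -> V -> Prop) (I J : finType).
Variables (q : I -> nat -> V) (s : J -> int -> V).
Hypotheses (qE : disjoint_rays E q) (sE : disjoint_lines E s).
Local Open Scope ring_scope.

(* Deferred acceptance, with walkers [i : I] proposing along [q i]: a walker
   standing at time [t i] on the line [a] is held if no walker has visited [a]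
   at a later position. *)
Definition held_at (t : I -> nat) (i : I) (a : J) (p : int) : Prop :=
  q i (t i) = s a p /\
  forall i' j' p', (j' <= t i')%N -> q i' j' = s a p' -> p' <= p.

Definition advance (t : I -> nat) (i : I) : nat :=
  if `[< exists a p, held_at t i a p >] then t i else (t i).+1.

Definition time (n : nat) : I -> nat := iter n advance (fun=> 0%N).

Definition reached (i : I) (j : nat) : Prop := exists n, (j <= time n i)%N.

Lemma time_leS n i : (time n i <= time n.+1 i <= (time n i).+1)%N.
Proof. by rewrite /= /advance; case: asboolP => _; lia. Qed.

Lemma time_le m n i : (m <= n)%N -> (time m i <= time n i)%N.
Proof.
elim: n => [|n IH]; first by rewrite leqn0 => /eqP ->.
rewrite leq_eqVlt => /orP[/eqP -> //|/IH]; move: (time_leS n i); lia.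
Qed.

Lemma frontier_max (t : I -> nat) (a : J) i p : q i (t i) = s a p ->
  exists i0 p0, q i0 (t i0) = s a p0 /\
    forall i' p', q i' (t i') = s a p' -> p' <= p0.
Proof.
move=> ip; pose P := fun i => `[< exists p, q i (t i) = s a p >].
have Pi : P i by apply/asboolP; exists p.
have /choice[f fP] : forall i, exists p, P i -> q i (t i) = s a p.
  move=> i'; have [[p' h]|np] := pselect (exists p, q i' (t i') = s a p).
    by exists p'.
  by exists 0 => /asboolP.
case: (Order.TotalTheory.arg_maxP f Pi) => i0 Pi0 mx.
exists i0, (f i0); split=> [|i' p' h]; first exact: fP.
have Pi' : P i' by apply/asboolP; exists p'.
suff -> : p' = f i' by apply: mx.
by have := fP i' Pi'; rewrite h => /(sE.1)[].
Qed.

(** A line never loses its holder: a held walker does not move, so the foremost walker on the line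
    one step later is at least as far along. On a line without a holder, induction excludes earlier
    visits, so the foremost current visitor is held. *)
Lemma visited_held n a i j p : (j <= time n i)%N -> q i j = s a p ->
  exists i0 p0, held_at (time n) i0 a p0.
Proof.
elim: n i j p => [|n IH] i j p.
  rewrite leqn0 => /eqP -> /(@frontier_max (fun=> 0%N))[i0 [p0 [h mx]]].
  exists i0, p0; split=> // i' j' p'.
  by rewrite leqn0 => /eqP ->; apply: mx.
move=> jn qsp.
have [[i1 [p1 [h1 mx1]]]|nov] := pselect (exists i p, held_at (time n) i a p).
  have e1 : time n.+1 i1 = time n i1.
    by rewrite /= /advance asboolT//; exists a, p1.
  have [i0 [p0 [h mx]]] : exists i0 p0, q i0 (time n.+1 i0) = s a p0 /\
      forall i' p', q i' (time n.+1 i') = s a p' -> p' <= p0.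
    by apply: (@frontier_max (time n.+1) a i1 p1); rewrite -[RHS]h1 e1.
  exists i0, p0; split=> // i' j' p' j'le h'.
  have p10 : p1 <= p0 by apply: (mx i1); rewrite e1.
  have [j'n|j'n] := leqP j' (time n i').
    by have := mx1 _ _ _ j'n h'; lia.
  apply: (mx i'); rewrite (_ : time n.+1 i' = j') //.
  by have := time_leS n i'; lia.
have fr i' j' p' : (j' <= time n.+1 i')%N -> q i' j' = s a p' ->
    j' = time n.+1 i'.
  move=> j'le h'; have [j'n|j'n] := leqP j' (time n i').
    by case: nov; have [i0 [p0 ?]] := IH _ _ _ j'n h'; exists i0, p0.
  by have := time_leS n i'; lia.
have := fr _ _ _ jn qsp => ej; move: qsp; rewrite ej.
move=> /frontier_max[i0 [p0 [h mx]]]; exists i0, p0; split=> // i' j' p' le' h'.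
by apply: (mx i'); rewrite -(fr _ _ _ le' h').
Qed.

Definition visited_lines : {set J} :=
  [set a | `[< exists i j p, reached i j /\ q i j = s a p >]].

(** At a time by which all visited lines have been visited, each has a holder, and disjointness of
    the lines makes these holders distinct. *)
Lemma card_visited_lines : (#|visited_lines| <= #|I|)%N.
Proof.
have [n nP] : exists n, forall a, a \in visited_lines ->
    exists i p, held_at (time n) i a p.
  have /choice[f fP] : forall a, exists n, a \in visited_lines ->
      exists i j p, (j <= time n i)%N /\ q i j = s a p.
    move=> a; have [|] := boolP (a \in visited_lines); last by exists 0%N.
    rewrite inE => /asboolP[i [j [p [[n jn] h]]]].
    by exists n => _; exists i, j, p.
  exists (\max_a f a)%N => a /fP[i [j [p [jn h]]]].
  apply: visited_held h; apply: leq_trans jn _.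
  exact/time_le/leq_bigmax.
have /choice[h hP] : forall x : {a | a \in visited_lines},
    exists i, exists p, held_at (time n) i (val x) p.
  by case=> a /= /nP[i [p]]; exists i, p.
rewrite -card_sig; apply: (@leq_card _ _ h) => x y hxy; apply/val_inj.
have [p [e1 _]] := hP x; have [p' [e2 _]] := hP y.
by move: e2; rewrite -hxy e1 => /(sE.1)[].
Qed.

Lemma reached_le i j j' : (j' <= j)%N -> reached i j -> reached i j'.
Proof. by move=> jj' [n jn]; exists n; apply: leq_trans jn. Qed.

Lemma reached0 i : reached i 0.
Proof. by exists 0%N. Qed.

(** A walker that never moves again is held at all later times, on the same line since it stays at
    one vertex. Every visit to that line, at whatever time, is therefore at or before its
    position. *)
Lemma stopped i t : reached i t -> ~ reached i t.+1 ->
  exists a p, q i t = s a p /\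
    forall i' j' p', reached i' j' -> q i' j' = s a p' -> p' <= p.
Proof.
move=> [n tn] nt.
have tm m : (n <= m)%N -> time m i = t.
  move=> nm; have := time_le i nm.
  case: (ltngtP (time m i) t) => [||//]; first by lia.
  by move=> tm; case: nt; exists m.
have hm m : (n <= m)%N -> exists a p, held_at (time m) i a p.
  move=> nm; have := tm m.+1 (leqW nm); rewrite /= /advance.
  by case: asboolP => // _; rewrite tm //; lia.
have [a [p [e mx]]] := hm n (leqnn n).
exists a, p; rewrite -(tm n (leqnn n)); split=> // i' j' p' [m jm] h.
have [|a' [p1 [e1 mx1]]] := hm (maxn n m); first exact: leq_maxl.
have := e1; rewrite tm ?leq_maxl// -(tm n (leqnn n)) e => /(sE.1)[? ?]; subst a' p1.
by apply: mx1 h; apply: leq_trans jm _; apply/time_le/leq_maxr.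
Qed.

(** The two cases are a walker that moves forever and one that is held from some time on and leaves
    along its line. *)
Definition rerouted_ray (i : I) (r : nat -> V) : Prop :=
  (forall j, reached i j /\ r j = q i j) \/
  exists t a p, [/\ reached i t, q i t = s a p,
    forall i' j' p', reached i' j' -> q i' j' = s a p' -> p' <= p &
    forall j, r j = if (j <= t)%N then q i j else s a (p + (j - t)%N%:Z)].

Lemma rerouted_ray_ex i : exists r, rerouted_ray i r.
Proof.
have [all|] := pselect (forall j, reached i j); first by exists (q i); left.
move=> /existsNP nall.
have nr : exists n, `[< ~ reached i n >] by case: nall => n ?; exists n; apply/asboolP.
have [[|t] /asboolP nt mn] := ex_minnP nr; first by case: (nt (reached0 i)).
have rt : reached i t.
  by apply: contrapT => /asboolP/mn; rewrite ltnn.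
have [a [p [e mx]]] := stopped rt nt.
by exists (fun j => if (j <= t)%N then q i j else s a (p + (j - t)%N%:Z));
  right; exists t, a, p.
Qed.

(* A vertex of a rerouted ray is either a visited vertex of [q i], or lies on
   the line where [i] is finally held, strictly after every visit. *)
Lemma rerouted_rayP i r j : rerouted_ray i r ->
  (reached i j /\ r j = q i j) \/
  exists t a p, [/\ reached i t, q i t = s a p,
    forall i' j' p', reached i' j' -> q i' j' = s a p' -> p' <= p,
    (t < j)%N & r j = s a (p + (j - t)%N%:Z)].
Proof.
case=> [/(_ j)|[t [a [p [rt e mx ->]]]]]; first by left.
case: leqP => jt; first by left; split=> //; apply: reached_le rt.
by right; exists t, a, p.
Qed.

(** Lines outside [C] stay disjoint from the new rays. The clause on [W] serves to confine the new
    rays to a set that contains the old ones and is closed under steps along the lines. *)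
Lemma reroute : exists (q' : I -> nat -> V) (C : {set J}),
  [/\ (#|C| <= #|I|)%N, disjoint_rays E q', forall i, q' i 0%N = q i 0%N,
      forall a i j p, q' i j = s a p -> a \in C &
      forall W : set V, (forall i j, W (q i j)) ->
        (forall a p, W (s a p) -> W (s a (p + 1))) -> forall i j, W (q' i j)].
Proof.
have /choice[q' q'P] := rerouted_ray_ex.
exists q', visited_lines; split.
- exact: card_visited_lines.
- split=> [i j i' j'|i j].
    case: (rerouted_rayP j (q'P i)) => [[rj ->]|[t [a [p [rt e mx tj ->]]]]];
    case: (rerouted_rayP j' (q'P i')) => [[rj' ->]|[t' [a' [p' [rt' e' mx' tj' ->]]]]].
    + exact: qE.1.
    + by move=> /mx' -/(_ rj); lia.
    + by move=> /esym/mx -/(_ rj'); lia.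
    (* Two walkers finally held on the same line bound each other's position, so they stand at the
       same vertex and coincide. *)
    + move=> /(sE.1)[? pp]; subst a'.
      have p1 := mx' _ _ _ rt e; have p2 := mx _ _ _ rt' e'.
      have p3 : p = p' by lia.
      subst p'; move: e'; rewrite -e => /(qE.1)[? ?]; subst i' t'.
      by split=> //; lia.
  case: (q'P i) => [h|[t [a [p [_ e _ h]]]]].
    by rewrite (h j).2 (h j.+1).2; apply: qE.2.
  rewrite !h; case: (ltngtP j t) => jt; first exact: qE.2.
    rewrite (_ : p + (j.+1 - t)%N%:Z = p + (j - t)%N%:Z + 1); first exact: sE.2.
    lia.
  rewrite jt e (_ : p + (t.+1 - t)%N%:Z = p + 1); first exact: sE.2.
  lia.
- move=> i; case: (q'P i) => [h|[t [a [p [_ _ _ h]]]]]; last by rewrite h.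
  by rewrite (h 0%N).2.
- move=> a i j p; rewrite inE.
  case: (rerouted_rayP j (q'P i)) => [[rj ->]|[t [b [p' [rt e _ _ ->]]]]] h.
    by apply/asboolP; exists i, j, p.
  by move: h => /(sE.1)[<- _]; apply/asboolP; exists i, t, p'.
- move=> W Wq Ws i j.
  case: (rerouted_rayP j (q'P i)) => [[rj ->]//|[t [a [p [_ e _ _ ->]]]]].
  elim: (j - t)%N => [|k IH]; first by rewrite GRing.addr0 -e.
  rewrite (_ : p + k.+1%:Z = p + k%:Z + 1); first exact: Ws.
  lia.
Qed.

End Reroute.

(** * Adding a line to a finite family, and passing to the limit *)

Section Extend.
Variables (V : Type) (E : V -> V -> Prop).
Local Open Scope ring_scope.

(* Keeping the segments [-M, M], the forward parts are rerouted inside [Wp]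
   and the backward parts inside [Wm]; together they touch at most [2 #|I|] of
   the lines [s], so one of these is left to be added to the family. *)
Lemma extend_lines (I J : finType) (R : I -> int -> V) (s : J -> int -> V)
    (M : nat) (Wp Wm : set V) :
  disjoint_lines E R -> disjoint_lines E s ->
  (#|I| + #|I| < #|J|)%N -> (0 < M)%N ->
  (forall v, Wp v -> Wm v -> False) ->
  (forall i (j : int), M%:Z <= j -> Wp (R i j)) ->
  (forall i (j : int), j <= - M%:Z -> Wm (R i j)) ->
  (forall a p i (j : int), - M%:Z < j < M%:Z -> s a p <> R i j) ->
  (forall a p, Wp (s a p) -> Wp (s a (p + 1))) ->
  (forall a p, Wm (s a (p + 1)) -> Wm (s a p)) ->
  exists (R' : I -> int -> V) (a : J),
    [/\ disjoint_lines E (fun o => if o is Some i then R' i else s a),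
        forall i (j : int), - M%:Z <= j <= M%:Z -> R' i j = R i j,
        forall i (j : int), M%:Z <= j -> Wp (R' i j) &
        forall i (j : int), j <= - M%:Z -> Wm (R' i j)].
Proof.
move=> RE sE ltIJ M0 Wpm RWp RWm sR sWp sWm.
(* The kept segments are open: the positions [M] and [- M] are the starts of the rerouted rays,
   which rerouting does not change. *)
pose mid := [set v | exists i (j : int), - M%:Z < j < M%:Z /\ v = R i j].
have qE : disjoint_rays E (fun i j => R i (M%:Z + j%:Z)).
  split=> [i j i' j' /(RE.1)[-> ?]|i j]; first by split=> //; lia.
  by rewrite (_ : M%:Z + j.+1%:Z = M%:Z + j%:Z + 1); [exact: RE.2|lia].
(* Backward parts are rays for the reversed edges, and the lines are read backwards as well. *)
have bE : disjoint_rays (fun x y => E y x) (fun i j => R i (- M%:Z - j%:Z)).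
  split=> [i j i' j' /(RE.1)[-> ?]|i j]; first by split=> //; lia.
  by rewrite (_ : - M%:Z - j%:Z = - M%:Z - j.+1%:Z + 1); [exact: RE.2|lia].
have sbE : disjoint_lines (fun x y => E y x) (fun a p => s a (- p)).
  split=> [a p a' p' /(sE.1)[-> ?]|a p]; first by split=> //; lia.
  by rewrite (_ : - p = - (p + 1) + 1); [exact: sE.2|lia].
have [f [C [cC fE f0 fC fW]]] := reroute qE sE.
have [b [B [cB bE' b0 bB bW]]] := reroute bE sbE.
(* The confining set is [Wp] without the kept segments, which the lines [s] never meet. *)
have {}fW i j : Wp (f i j) /\ ~ mid (f i j).
  apply: (fW [set v | Wp v /\ ~ mid v]) => [i' j'|a p [h nm]] /=.
    split; first by apply: RWp; lia.
    by move=> [i1 [j1 [lj /(RE.1)[_ ?]]]]; lia.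
  split; first exact: sWp.
  by move=> [i1 [j1 [lj]]]; apply: sR.
have {}bW i j : Wm (b i j) /\ ~ mid (b i j).
  apply: (bW [set v | Wm v /\ ~ mid v]) => [i' j'|a p [h nm]] /=.
    split; first by apply: RWm; lia.
    by move=> [i1 [j1 [lj /(RE.1)[_ ?]]]]; lia.
  split; first by apply: sWm; rewrite (_ : - (p + 1) + 1 = - p) //; lia.
  by move=> [i1 [j1 [lj]]]; apply: sR.
have [a aCB] : exists a, a \notin (C :|: B)%SET.
  apply: contrapT => /forallNP h.
  have : (#|J| <= #|(C :|: B)%SET|)%N.
    by apply/subset_leq_card/fintype.subsetP => a _; have /negP := h a; rewrite negbK.
  have := (leq_card_setU C B).1; lia.
have [aC aB] : a \notin C /\ a \notin B.
  by move: aCB; rewrite finset.inE negb_or => /andP[].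
pose R' i (j : int) := if M%:Z <= j then f i (absz (j - M%:Z)%R)
  else if j <= - M%:Z then b i (absz (- M%:Z - j)%R) else R i j.
have R'P i j : [\/ M%:Z <= j /\ R' i j = f i (absz (j - M%:Z)%R),
    j <= - M%:Z /\ R' i j = b i (absz (- M%:Z - j)%R) |
    - M%:Z < j < M%:Z /\ R' i j = R i j].
  rewrite /R'; case: ifP => h1; first by constructor 1.
  by case: ifP => h2; [constructor 2|constructor 3; split=> //; lia].
have R'm i j : - M%:Z < j < M%:Z -> mid (R i j) by move=> ?; exists i, j.
have aR' i j p : R' i j <> s a p.
  case: (R'P i j) => -[lj ->].
  - by move=> e; move: aC; rewrite (fC _ _ _ _ e).
  - by rewrite -(GRing.opprK p) => e; move: aB; rewrite (bB _ _ _ _ e).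
  - by move=> /esym; exact: sR.
exists R', a; split.
- split=> [[i|] j [i'|] j'|[i|] j] //=.
  + case: (R'P i j) => -[lj ->]; case: (R'P i' j') => -[lj' ->] => e.
    * by have [-> ?] := fE.1 _ _ _ _ e; split=> //; lia.
    * by case: (Wpm (f i (absz (j - M%:Z)%R))); [case: (fW i (absz (j - M%:Z)%R))|
        rewrite e; case: (bW i' (absz (- M%:Z - j')%R))].
    * by case: (fW i (absz (j - M%:Z)%R)) => _ []; rewrite e; apply: R'm.
    * by case: (Wpm (b i (absz (- M%:Z - j)%R))); [
        rewrite e; case: (fW i' (absz (j' - M%:Z)%R))|case: (bW i (absz (- M%:Z - j)%R))].
    * by have [-> ?] := bE'.1 _ _ _ _ e; split=> //; lia.
    * by case: (bW i (absz (- M%:Z - j)%R)) => _ []; rewrite e; apply: R'm.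
    * by case: (fW i' (absz (j' - M%:Z)%R)) => _ []; rewrite -e; apply: R'm.
    * by case: (bW i' (absz (- M%:Z - j')%R)) => _ []; rewrite -e; apply: R'm.
    * by have [-> ?] := RE.1 _ _ _ _ e.
  + by move=> /aR'.
  + by move=> /esym /aR'.
  + by move=> /(sE.1)[_ ->].
  + case: (R'P i j) => -[lj ->]; case: (R'P i (j + 1)) => -[lj' ->]; try lia.
    * rewrite (_ : absz (j + 1 - M%:Z)%R = (absz (j - M%:Z)%R).+1); [exact: fE.2|lia].
    * rewrite (_ : absz (- M%:Z - j)%R = (absz (- M%:Z - (j + 1))%R).+1);
        [exact: bE'.2|lia].
    (* At the two junctions the rerouted ray still begins at its old vertex, so the old edge
       serves. *)
    * rewrite (_ : absz (- M%:Z - j)%R = 0%N); last lia.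
      by rewrite b0 (_ : - M%:Z - 0%:Z = j); [exact: RE.2|lia].
    * rewrite (_ : absz (j + 1 - M%:Z)%R = 0%N); last lia.
      by rewrite f0 (_ : M%:Z + 0%:Z = j + 1); [exact: RE.2|lia].
    * exact: RE.2.
  + exact: sE.2.
- move=> i j lj; case: (R'P i j) => -[lj' ->//].
  + rewrite (_ : absz (j - M%:Z)%R = 0%N); last lia.
    by rewrite f0; congr (R i _); lia.
  + rewrite (_ : absz (- M%:Z - j)%R = 0%N); last lia.
    by rewrite b0; congr (R i _); lia.
- move=> i j lj; case: (R'P i j) => -[lj' ->]; try lia.
  by case: (fW i (absz (j - M%:Z)%R)).
- move=> i j lj; case: (R'P i j) => -[lj' ->]; try lia.
  by case: (bW i (absz (- M%:Z - j)%R)).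
Qed.

(* The infinite family is the limit of finite ones: the n-th line is
   eventually constant on every bounded segment. *)
Lemma limit_lines (v0 : V) (G : (int -> V) -> Prop) :
  (forall k (R : nat -> int -> V) (m : nat),
    disjoint_lines E (fun i : 'I_k => R i) -> (forall i, (i < k)%N -> G (R i)) ->
    exists R' : nat -> int -> V,
      [/\ disjoint_lines E (fun i : 'I_k.+1 => R' i),
          forall i, (i < k.+1)%N -> G (R' i) &
          forall i (j : int), (i < k)%N -> - m%:Z <= j <= m%:Z -> R' i j = R i j]) ->
  exists R : nat -> int -> V, disjoint_lines E R.
Proof.
move=> step.
pose good k (R : nat -> int -> V) :=
  disjoint_lines E (fun i : 'I_k => R i) /\ forall i, (i < k)%N -> G (R i).
have /choice[next nextP] : forall x : nat * (nat -> int -> V),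
    exists R', good x.1 x.2 -> good x.1.+1 R' /\
      forall i j, (i < x.1)%N -> - x.1%:Z <= j <= x.1%:Z -> R' i j = x.2 i j.
  move=> [k R]; have [[g1 g2]|ng] := pselect (good k R); last by exists R.
  by have [R' [? ? ?]] := step k R k g1 g2; exists R'.
(* Stage [n] consists of [n] lines and is extended with the segment [-n, n] fixed; at stage 0 the
   family is empty and [v0] is a mere placeholder. *)
pose F := fix F n := if n is m.+1 then next (m, F m) else fun _ _ => v0.
have gF n : good n (F n).
  elim: n => [|n IH]; first by split=> [|//]; split=> -[].
  exact: (nextP (n, F n) IH).1.
have FS n i j : (i < n)%N -> - n%:Z <= j <= n%:Z -> F n.+1 i j = F n i j.
  exact: (nextP (n, F n) (gF n)).2.
have Fle n m i j : (n <= m)%N -> (i < n)%N -> - n%:Z <= j <= n%:Z ->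
    F m i j = F n i j.
  elim: m => [|m IH]; first by rewrite leqn0 => /eqP ->.
  rewrite leq_eqVlt => /orP[/eqP -> //|nm] lin lj.
  by rewrite FS ?IH//; lia.
(* This stage exceeds both [i] and the absolute value of [j], so the value no longer changes. *)
pose R i (j : int) := F (i + `|j|).+1 i j.
have RF n i j : (i + `|j| < n)%N -> R i j = F n i j.
  by move=> h; rewrite /R (Fle (i + `|j|).+1 n) //; lia.
exists R; split=> [i j i' j'|i j].
  pose n := (i + `|j| + (i' + `|j'|)).+1.
  rewrite (RF n) ?(RF n i'); [|rewrite /n; lia..].
  have li : (i < n)%N by rewrite /n; lia.
  have li' : (i' < n)%N by rewrite /n; lia.
  by move=> /((gF n).1.1 (Ordinal li) _ (Ordinal li'))[[->] ->].
pose n := (i + `|j|).+2.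
rewrite (RF n) ?(RF n _ (j + 1)); [|rewrite /n; lia..].
have li : (i < n)%N by rewrite /n; lia.
exact: ((gF n).1.2 (Ordinal li)).
Qed.

End Extend.

Section Supply.
Variables (V : Type) (E : V -> V -> Prop).
Local Open Scope ring_scope.

(** The common frame of both cases: [G] is the invariant that lets the construction continue, and 2k
    + 1 fresh lines leave one untouched after k forward and k backward parts are rerouted. *)
Lemma infinitely_many_lines (v0 : V) (G : (int -> V) -> Prop) :
  (forall k (R : 'I_k -> int -> V) (m : nat),
    disjoint_lines E R -> (forall i, G (R i)) ->
    exists (M : nat) (Wp Wm : set V) (s : 'I_(k + k).+1 -> int -> V),
    [/\ (m < M)%N,
        disjoint_lines E s /\ forall a, G (s a),
        (forall v, Wp v -> Wm v -> False) /\
          (forall a p i (j : int), - M%:Z < j < M%:Z -> s a p <> R i j),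
        (forall i (j : int), M%:Z <= j -> Wp (R i j)) /\
          (forall i (j : int), j <= - M%:Z -> Wm (R i j)) &
        [/\ forall a p, Wp (s a p) -> Wp (s a (p + 1)),
          forall a p, Wm (s a (p + 1)) -> Wm (s a p) &
          forall r, (forall j : int, M%:Z <= j -> Wp (r j)) ->
            (forall j : int, j <= - M%:Z -> Wm (r j)) -> G r]]) ->
  exists R : nat -> int -> V, disjoint_lines E R.
Proof.
move=> supply; apply: (limit_lines v0 (G := G)) => k R m RE RG.
have [M [Wp [Wm [s [mM [sE sG] [Wpm sR] [RWp RWm] [sWp sWm WG]]]]]] :=
  supply k _ m RE (fun i => RG i (ltn_ord i)).
have [||R' [a [R'E R'R R'Wp R'Wm]]] :=
    extend_lines RE sE _ _ Wpm RWp RWm sR sWp sWm.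
- by rewrite !card_ord.
- lia.
(* Indices below [k] keep their line; all others receive the new one. *)
pose pick n : option 'I_k := insub n.
exists (fun n => if pick n is Some i then R' i else s a).
have pickT n (nk : (n < k)%N) : pick n = Some (Ordinal nk).
  by rewrite /pick insubT.
split.
- split=> [i j i' j' /(R'E.1 (pick i) j (pick i'))[ii' ->]|i j].
    split=> //; apply/val_inj => /=; have := ltn_ord i; have := ltn_ord i'.
    move: ii'; rewrite /pick; case: insubP => [x _ <-|ik]; case: insubP => //.
      by move=> y _ <- [->].
    by move=> i'k _; lia.
  exact: (R'E.2 (pick i)).
- move=> i _; case: (pick i) => [i'|]; last exact: sG.
  by apply: WG => j; [apply: R'Wp|apply: R'Wm].
- by move=> i j ik lj; rewrite (pickT i ik) R'R //=; lia.
Qed.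

End Supply.

(** * Double rays as sequences indexed by the integers *)

Section Lines.
Variable V : Type.
Implicit Types (D R S T : digraph V) (s : int -> V).
Local Open Scope ring_scope.

Lemma card_I1P (A : set V) : A #= `I_1 -> exists x, forall y, A y <-> y = x.
Proof.
move=> /eq_cardSP[x Ax]; rewrite II0 card_eq0 => /eqP A0; exists x => y.
split=> [Ay|-> //]; apply: contrapT => yx.
by have : (A `\ x) y by []; rewrite A0.
Qed.

Lemma card_I1 (A : set V) x : (forall y, A y <-> y = x) -> A #= `I_1.
Proof.
move=> Ax; rewrite (_ : A = [set x]) ?card_set1//.
by apply/seteqP; split=> y /Ax.
Qed.

Lemma infinite_set_inj (T : Type) (A : set T) (f : nat -> T) :
  injective f -> (forall n, A (f n)) -> infinite_set A.
Proof.
move=> fi fA /(@finite_preimage _ _ _ f) fin.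
apply: infinite_nat; suff <- : f @^-1` A = setT.
  by apply: fin => x y _ _ /fi.
by apply/seteqP; split=> // n _; apply: fA.
Qed.

Definition line_of R s : Prop :=
  [/\ injective s, vset R = range s &
      forall x y, edge R x y <-> exists j, x = s j /\ y = s (j + 1)].

(** Iterating the unique successor and predecessor from a vertex gives the sequence; connectedness
    makes it exhaust [R], and infinity makes it injective. *)
Lemma double_ray_line R : double_ray R -> exists s, line_of R s.
Proof.
move=> [Rinf Rdeg Rconn].
have [v0 Rv0] := infinite_setN0 Rinf.
have /choice[nx nxP] : forall v, exists w, vset R v ->
    forall x, edge R v x <-> x = w.
  move=> v; have [Rv|] := pselect (vset R v); last by exists v.
  have [/card_I1P[w e] _] := Rdeg v Rv; exists w => _; exact: e.
have /choice[pv pvP] : forall v, exists w, vset R v ->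
    forall x, edge R x v <-> x = w.
  move=> v; have [Rv|] := pselect (vset R v); last by exists v.
  have [_ /card_I1P[w e]] := Rdeg v Rv; exists w => _; exact: e.
have edge_nx v : vset R v -> edge R v (nx v) by move=> Rv; apply/(nxP v Rv).
have edge_pv v : vset R v -> edge R (pv v) v by move=> Rv; apply/(pvP v Rv).
have nxE v x : edge R v x -> x = nx v.
  by move=> vx; have [Rv _] := edge_vset vx; apply/(nxP v Rv).
have pvE v x : edge R x v -> x = pv v.
  by move=> xv; have [_ Rv] := edge_vset xv; apply/(pvP v Rv).
have Rnx v : vset R v -> vset R (nx v) by move=> Rv; have [] := edge_vset (edge_nx v Rv).
have Rpv v : vset R v -> vset R (pv v) by move=> Rv; have [] := edge_vset (edge_pv v Rv).
pose s (j : int) := match j with Posz n => iter n nx v0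
                            | Negz n => iter n.+1 pv v0 end.
have sR j : vset R (s j).
  by case: j => n; rewrite /s; [|move: n.+1 => {}n]; elim: n => //= n IH; auto.
have nxpv v : vset R v -> nx (pv v) = v.
  by move=> Rv; rewrite -(nxE _ _ (edge_pv v Rv)).
have snx j : s (j + 1) = nx (s j).
  case: j => [n|[|n]]; first by rewrite (_ : Posz n + 1 = Posz n.+1) //; lia.
    by rewrite (_ : Negz 0 + 1 = Posz 0) //= nxpv.
  rewrite (_ : Negz n.+1 + 1 = Negz n); last lia.
  by have -> : s (Negz n.+1) = pv (s (Negz n)) by []; rewrite nxpv.
have sedge j : edge R (s j) (s (j + 1)) by rewrite snx; apply: edge_nx.
have spv j : s (j - 1) = pv (s j).
  by apply: pvE; have := sedge (j - 1); rewrite GRing.subrK.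
have Rs : vset R = range s.
  apply/seteqP; split=> [w Rw|_ [j _ <-]] //.
  (* Unique neighbours force the dipath to follow the iterates, forwards from [v0] or backwards from
     its end at [v0]. *)
  have [P [_ PR] [] [n [f [f0 fn _ _ fE]]]] := Rconn v0 w Rv0 Rw.
    exists n%:Z => //; rewrite -fn.
    elim: {-2}n (leqnn n) => [|m IH] mn; first by rewrite f0.
    rewrite (_ : m.+1%:Z = m%:Z + 1) ?snx ?IH; [|lia..].
    by apply/esym/nxE/PR/fE; exists m.
  exists (- n%:Z) => //; rewrite -f0.
  suff h m : (m <= n)%N -> s (- m%:Z) = f (n - m)%N by rewrite h// subnn.
  elim: m => [|m IH] mn; first by rewrite subn0 fn.
  rewrite (_ : - m.+1%:Z = - m%:Z - 1) ?spv ?IH; [|lia..].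
  apply/esym/pvE/PR/fE; exists (n - m.+1)%N; [lia|split=> //; congr f; lia].
exists s; split=> //; last first.
  move=> x y; split=> [xy|[j [-> ->]] //].
  have [Rx _] := edge_vset xy; move: (Rx); rewrite Rs => -[j _ ej].
  by exists j; rewrite snx ej; split=> //; apply: nxE.
suff inj i j : i < j -> s i <> s j.
  move=> i j sij; have [/inj//|/inj/nesym//|//] := Order.TotalTheory.ltgtP i j.
move=> ij eij; apply: Rinf.
(* A repetition closes the segment from [i] to [j] into a cycle [F], closed under successors and
   predecessors, so [R] would be finite. *)
pose F := (fun t : nat => s (i + t%:Z)) @` `I_(absz (j - i)%R).
have Fs (n : nat) : F (s (i + n%:Z)) /\ F (s (i - n%:Z)).
  elim: n => [|n [[t /= lt e] [t' /= lt' e']]].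
    by split; exists 0%N => /=; [lia|congr s; lia|lia|congr s; lia].
  split.
    rewrite (_ : i + n.+1%:Z = i + n%:Z + 1); last lia.
    rewrite snx -e -snx.
    have [tl|tl] := ltnP t.+1 (absz (j - i)%R).
      by exists t.+1 => //; congr s; lia.
    exists 0%N => /=; first by lia.
    by rewrite GRing.addr0 eij; congr s; lia.
  rewrite (_ : i - n.+1%:Z = i - n%:Z - 1); last lia.
  rewrite spv -e' -spv; case: t' lt' {e'} => [|t'] lt'.
    exists (absz (j - i)%R).-1 => /=; first by lia.
    by rewrite GRing.addr0 spv eij -spv; congr s; lia.
  by exists t' => /=; [lia|congr s; lia].
have RF : vset R `<=` F.
  rewrite Rs => _ [p _ <-]; have [h|h] := boolP (i <= p).
    by have := (Fs (absz (p - i)%R)).1; congr (F (s _)); lia.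
  by have := (Fs (absz (i - p)%R)).2; congr (F (s _)); lia.
apply: sub_finite_set RF _; apply: finite_image; exact: finite_II.
Qed.

Variables (D : digraph V).

Section OfLine.
Variables (s : int -> V) (sE : forall j, edge D (s j) (s (j + 1))).

Definition line_graph : digraph V :=
  @Digraph V (range s) (fun x y => exists j, x = s j /\ y = s (j + 1))
    (fun x y xy => let: ex_intro j (conj ex ey) := xy in
      conj (ex_intro2 _ _ j I (esym ex)) (ex_intro2 _ _ (j + 1) I (esym ey))).

Lemma line_graph_subdigraph : subdigraph line_graph D.
Proof.
by split=> [_ [j _ <-]|_ _ [j [-> ->]]] //; have [] := edge_vset (sE j).
Qed.

Lemma line_graph_line : injective s -> line_of line_graph s.
Proof. by split. Qed.

End OfLine.

Lemma interval_dipath R s (n : nat) (j : int) : line_of R s ->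
  exists2 P, subdigraph P R & dipath P (s j) (s (j + n%:Z)).
Proof.
move=> [inj Rs sE].
pose f k := s (j + k%:Z).
have PV u v : (exists2 k, (k < n)%N & u = f k /\ v = f k.+1) ->
    (f @` `I_n.+1) u /\ (f @` `I_n.+1) v.
  by move=> [k kn [-> ->]]; split; [exists k|exists k.+1] => //=; lia.
exists (Digraph PV).
  split=> [_ [k _ <-]|_ _ [k _ [-> ->]]]; first by rewrite Rs; exists (j + k%:Z).
  by apply/sE; exists (j + k%:Z); split=> //; rewrite /f; congr s; lia.
exists n, f; split=> //; first by rewrite /f GRing.addr0.
by move=> k l _ _ /inj; lia.
Qed.

Lemma line_degree R s v : line_of R s -> vset R v ->
  out_degree_is R v 1 /\ in_degree_is R v 1.
Proof.
move=> [inj -> sE] [j _ <-]; split.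
  apply: (@card_I1 _ (s (j + 1))) => w; split=> [/sE[k [/inj <- ->]]|->] //.
  by apply/sE; exists j.
apply: (@card_I1 _ (s (j - 1))) => w; split=> [/sE[k [-> /inj ->]]|->].
  by rewrite /= GRing.addrK.
by apply/sE; exists (j - 1); rewrite GRing.subrK.
Qed.

Lemma line_double_ray R s : line_of R s -> double_ray R.
Proof.
move=> Rs; have [inj e _] := Rs; split=> [|v|v w].
- apply: (@infinite_set_inj _ _ (fun n : nat => s n%:Z)) => [n m /inj[]|n] //.
  by rewrite e; exists n%:Z.
- exact: line_degree Rs.
- rewrite e => -[i _ <-] [j _ <-]; have [h|h] := boolP (i <= j).
    have [P PR] := interval_dipath (absz (j - i)%R) i Rs.
    by rewrite (_ : i + _ = j); [exists P; [|left]|lia].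
  have [P PR] := interval_dipath (absz (i - j)%R) j Rs.
  by rewrite (_ : j + _ = i); [exists P; [|right]|lia].
Qed.

Definition forward_part s : set V := [set s j | j in [set j : int | 0 <= j]].
Definition backward_part s : set V := [set s j | j in [set j : int | j <= 0]].

Lemma forward_ray R s : line_of R s ->
  exists T, [/\ tail R T, ray T & vset T = forward_part s].
Proof.
move=> Rs; have [inj e sE] := Rs.
have TV u v : (exists j : int, [/\ 0 <= j, u = s j & v = s (j + 1)]) ->
    forward_part s u /\ forward_part s v.
  by move=> [j [j0 -> ->]]; split; [exists j|exists (j + 1)] => //=; lia.
pose T := Digraph TV.
have T0 : ray_from T (s 0).
  split; first by exists 0.
  - split.
      apply: (@card_I1 _ (s 1)) => w; split=> [/= [j [_ /inj <- ->]]|->] //=.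
      by exists 0.
    rewrite /in_degree_is (_ : mkset _ = set0) ?II0 ?card_eqxx//.
    by apply/seteqP; split=> // w /= [j [j0 _ /inj]]; lia.
  - move=> _ [j j0 <-].
    pose f k := s k%:Z; pose n := absz j.
    have PV u v : (exists2 k, (k < n)%N & u = f k /\ v = f k.+1) ->
        (f @` `I_n.+1) u /\ (f @` `I_n.+1) v.
      by move=> [k kn [-> ->]]; split; [exists k|exists k.+1] => //=; lia.
    exists (Digraph PV).
      split=> [_ [k _ <-]|_ _ [k _ [-> ->]]]; first by exists k%:Z.
      by exists k%:Z; split=> //; rewrite /f; congr s; lia.
    exists n, f; split=> //; first by rewrite /f /n; congr s; move: j0 => /=; lia.
    by move=> k l _ _ /inj; lia.
  move=> _ [j /= j0 <-] js0; split.
    apply: (@card_I1 _ (s (j + 1))) => w; split=> [/= [k [_ /inj <- ->]]|->] //=.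
    by exists j.
  apply: (@card_I1 _ (s (j - 1))) => w; split=> [/= [k [_ -> /inj ->]]|->] /=.
    by rewrite GRing.addrK.
  exists (j - 1); rewrite GRing.subrK; split=> //.
  by have : j <> 0 by [move=> j00; apply: js0; rewrite j00]; lia.
exists T; split=> //; last by exists (s 0).
split.
  split=> [_ [j _ <-]|_ _ [j [_ -> ->]]]; first by rewrite e; exists j.
  by apply/sE; exists j.
by exists (s 0); [rewrite e; exists 0|left].
Qed.

(** Each vertex of a forward tail has an out-edge in [T], which must be the one edge that [R]
    offers, so the tail never leaves the line. Backward tails are dual. *)
Lemma tail_contains R s T : line_of R s -> tail R T ->
  (ray T \/ antiray T) /\ exists m : int,
    (forall j, m <= j -> vset T (s j)) \/ (forall j, j <= m -> vset T (s j)).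
Proof.
move=> [inj e sE] [[TR TRE] [u Ru uT]].
split; first by case: uT => h; [left|right]; exists u.
move: Ru; rewrite e => -[m _ mu]; exists m.
have outT v : ray_from T u -> vset T v -> out_degree_is T v 1.
  move=> [_ [h _] _ hT] Tv; have [->//|vu] := pselect (v = u).
  by have [] := hT v Tv vu.
have inT v : antiray_to T u -> vset T v -> in_degree_is T v 1.
  move=> [_ [h _] _ hT] Tv; have [->//|vu] := pselect (v = u).
  by have [] := hT v Tv vu.
case: uT => uT; [left|right] => j mj.
  rewrite (_ : j = m + (absz (j - m)%R)%:Z); last lia.
  elim: (absz _) => [|n IH]; first by rewrite GRing.addr0 mu; case: uT.
  have /card_I1P[w ew] := outT _ uT IH.
  have Tw : edge T (s (m + n%:Z)) w by exact/ew.
  have /TRE/sE[k [/inj <- ew']] := Tw.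
  have [_] := edge_vset Tw; rewrite ew' (_ : m + n%:Z + 1 = m + n.+1%:Z) //; lia.
rewrite (_ : j = m - (absz (m - j)%R)%:Z); last lia.
elim: (absz _) => [|n IH]; first by rewrite GRing.subr0 mu; case: uT.
have /card_I1P[w ew] := inT _ uT IH.
have Tw : edge T w (s (m - n%:Z)) by exact/ew.
have /TRE/sE[k [ew' /inj ek]] := Tw.
by have [] := edge_vset Tw; rewrite ew' (_ : k = m - n.+1%:Z) //; lia.
Qed.

Lemma disjoint_lines_double_rays (R : nat -> int -> V) :
  disjoint_lines (edge D) R ->
  exists S : set (digraph V), infinite_set S /\ disjoint_double_rays D S.
Proof.
move=> [inj RE]; exists (range (fun n => line_graph (R n))); split.
  apply: (@infinite_set_inj _ _ (fun n => line_graph (R n))) => [n m nm|n].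
    have : vset (line_graph (R m)) (R n 0) by rewrite -nm; exists 0.
    by move=> [j _ /inj[->]].
  by exists n.
split=> [_ [n _ <-]|_ _ [n _ <-] [m _ <-] [v [[j _ <-] [j' _ /inj[->]]]]] //.
split; first exact/line_graph_subdigraph/RE.
by apply: line_double_ray (line_graph_line _) => i j /inj[].
Qed.

End Lines.

(** * Finite separation and infinitely many disjoint dipaths *)

Section Linkage.
Variables (V : Type) (D : digraph V).
Implicit Types (A B X : set V).

Inductive reach X A : V -> Prop :=
| reach_start v : A v -> ~ X v -> reach X A v
| reach_step u v : reach X A u -> edge D u v -> ~ X v -> reach X A v.

Definition linked A B : Prop :=
  forall X, finite_set X -> exists2 v, reach X A v & B v.

Definition walk X A B n (f : nat -> V) : Prop :=
  [/\ A (f 0), B (f n), forall i, i < n -> edge D (f i) (f i.+1) &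
      forall i, i <= n -> ~ X (f i)].

Lemma reach_walk X A v : reach X A v -> exists n f, walk X A [set v] n f.
Proof.
elim=> [{}v Av Xv|u {}v _ [n [f [f0 fn fE fX]]] uv Xv].
  by exists 0, (fun=> v); split=> //.
exists n.+1, (fun i => if i <= n then f i else v); split=> //=.
- by rewrite ltnn.
- move=> i; rewrite ltnS => lin; rewrite lin; case: ltngtP lin => // [lin _|-> _].
    exact: fE.
  by rewrite fn.
- by move=> i lin; case: ifP => // /fX.
Qed.

(** A shortest walk from [A] to [B] off [X] repeats no vertex and meets [A] only at its start and
    [B] only at its end. *)
Lemma linked_dipath A B X : A `<=` vset D -> finite_set X -> linked A B ->
  exists P, [/\ subdigraph P D, set_dipath A B P & vset P `&` X = set0].
Proof.
move=> AD finX /(_ X finX)[v Av Bv].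
have ex : exists n, `[< exists f, walk X A B n f >].
  have [n [f [f0 fn fE fX]]] := reach_walk Av; exists n; apply/asboolP; exists f.
  by split=> //; rewrite fn.
have [n /asboolP[f [f0 fn fE fX]] mn] := ex_minnP ex.
have {}mn m g : walk X A B m g -> n <= m.
  by move=> h; apply: mn; apply/asboolP; exists g.
have fA i : i <= n -> A (f i) -> i = 0.
  move=> lin Ai; have := mn (n - i) (fun k => f (i + k)).
  suff h : walk X A B (n - i) (fun k => f (i + k)) by move=> /(_ h); lia.
  split; rewrite ?addn0 ?subnKC // => k lk; first by rewrite addnS; apply: fE; lia.
  by apply: fX; lia.
have fB i : i <= n -> B (f i) -> i = n.
  move=> lin Bi; have := mn i f.
  suff h : walk X A B i f by move=> /(_ h); lia.
  by split=> // k lk; [apply: fE|apply: fX]; lia.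
have finj i j : i < j -> j <= n -> f i <> f j.
  move=> ij jn eij; pose g k := if k <= i then f k else f (k + (j - i)).
  suff h : walk X A B (n - (j - i)) g by have := mn _ _ h; lia.
  split.
  - by rewrite /g leq0n.
  - rewrite /g; case: ifP => h; last by rewrite subnK //; lia.
    have -> : n - (j - i) = i by lia.
    by have -> // : f i = f n by rewrite eij; congr f; lia.
  - move=> k lk; rewrite /g; case: (ltngtP k i) => ki.
    + by apply: fE; lia.
    + by rewrite addSn; apply: fE; lia.
    + by rewrite ki eij addSn (_ : i + (j - i) = j); [apply: fE|]; lia.
  - by move=> k lk; rewrite /g; case: ifP => _; apply: fX; lia.
have PV u w : (exists2 k, k < n & u = f k /\ w = f k.+1) ->
    (f @` `I_n.+1) u /\ (f @` `I_n.+1) w.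
  by move=> [k kn [-> ->]]; split; [exists k|exists k.+1] => //=; lia.
exists (Digraph PV); split.
(* The start needs [AD], since a walk of length 0 has no edge to place it in [D]. *)
- split=> [_ [[|k] /= kn <-]|_ _ [k kn [-> ->]]]; last exact: fE.
    exact: AD.
  by have [] := edge_vset (fE k kn).
- exists (f 0), (f n); split=> //.
    exists n, f; split=> // i j li lj eij; case: (ltngtP i j) => // h.
      by case: (finj _ _ h lj).
    by case: (finj _ _ h li).
  move=> _ [[k /= kn <-] [/fA|/fB]] -> //; [left|right]=> //.
- by apply/seteqP; split=> // _ [[k /= kn <-]]; apply: fX.
Qed.

(** Greedy choice: each dipath avoids the finite union of the earlier ones. *)
Lemma linked_infinitely_many A B : A `<=` vset D -> linked A B ->
  exists S, [/\ infinite_set S, pairwise_disjoint S &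
    forall P, S P -> subdigraph P D /\ set_dipath A B P].
Proof.
move=> AD AB.
have fin_dipath (P : digraph V) u v : dipath P u v -> finite_set (vset P).
  by move=> [n [f [_ _ _ -> _]]]; apply/finite_image/finite_II.
have /choice[next nextP] : forall X, exists P, finite_set X ->
    [/\ subdigraph P D, set_dipath A B P & vset P `&` X = set0].
  move=> X; have [fX|] := pselect (finite_set X); last by exists D.
  by have [P PP] := linked_dipath AD fX AB; exists P.
pose F := fix F n := if n is m.+1 then F m `|` vset (next (F m)) else set0.
have Ffin n : finite_set (F n).
  elim: n => [|n IH] /=; first exact: finite_set0.
  rewrite finite_setU; split=> //.
  by have [_ [u [v [h _ _ _]]] _] := nextP _ IH; apply: fin_dipath h.
have Fsub m n : m < n -> vset (next (F m)) `<=` F n.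
  elim: n => // n IH; rewrite ltnS leq_eqVlt => /orP[/eqP ->|/IH h] x hx /=.
    by right.
  by left; apply: h.
have disj m n x : vset (next (F m)) x -> vset (next (F n)) x -> m = n.
  wlog mn : m n / m < n.
    by move=> h hm hn; case: (ltngtP m n) => // lt; [apply: h|apply/esym/h].
  move=> hm hn; have [_ _ /seteqP[e _]] := nextP _ (Ffin n).
  by case: (e x); split=> //; apply: Fsub hm.
exists (range (fun n => next (F n))); split.
- apply: (@infinite_set_inj _ _ (fun n => next (F n))) => [m n mn|n]; last by exists n.
  have [_ [u [v [[k [f [_ _ _ Pf _]]] _ _ _]]] _] := nextP _ (Ffin m).
  have fx : vset (next (F m)) (f 0) by rewrite Pf; exists 0.
  by apply: (disj _ _ _ fx); rewrite -mn.
- by move=> _ _ [m _ <-] [n _ <-] [x [hm hn]]; rewrite (disj _ _ _ hm hn).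
- by move=> _ [n _ <-]; have [? ? _] := nextP _ (Ffin n).
Qed.

End Linkage.

(** * Vertex sets met by almost every double ray *)

Section Opposite.
Variable V : Type.
Local Open Scope ring_scope.

Lemma disjoint_lines_opp (E : V -> V -> Prop) (I : Type) (s : I -> int -> V) :
  disjoint_lines E s -> disjoint_lines (fun x y => E y x) (fun i j => s i (- j)).
Proof.
move=> [inj sE]; split=> [i j i' j' /inj[-> ?]|i j]; first by split=> //; lia.
by rewrite (_ : - j = - (j + 1) + 1); [exact: sE|lia].
Qed.

Lemma forward_part_opp (s : int -> V) :
  forward_part (fun j => s (- j)) = backward_part s.
Proof.
apply/seteqP; split=> _ [j /= j0 <-].
  by exists (- j) => //=; lia.
by exists (- j); rewrite /= ?GRing.opprK //; lia.
Qed.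

End Opposite.

(** * The case of forward parts that are not hit *)

Section Unhit.
Variables (V : Type) (E : V -> V -> Prop) (hit : set V -> Prop).
Hypotheses (hitS : forall A B, A `<=` B -> hit A -> hit B)
  (hit1 : forall v, ~ hit [set v])
  (hit_bigcup : forall (I : finType) (A : I -> set V),
    (forall i, ~ hit (A i)) -> ~ hit [set v | exists i, A i v]).
Local Open Scope ring_scope.

Lemma unhitU A B : ~ hit A -> ~ hit B -> ~ hit (A `|` B).
Proof.
move=> hA hB; have h := @hit_bigcup bool (fun b => if b then A else B).
apply: contra_not (h _) => [|[]//]; apply: hitS => v [Av|Bv]; first by exists true.
by exists false.
Qed.

Lemma unhit_segment (I : finType) (R : I -> int -> V) (M : nat) :
  ~ hit [set v | exists i (j : int), - M%:Z <= j <= M%:Z /\ v = R i j].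
Proof.
have h := @hit_bigcup (I * 'I_(M + M).+1)%type
  (fun x => [set R x.1 ((x.2 : nat)%:Z - M%:Z)]).
apply: contra_not (h (fun=> @hit1 _)); apply: hitS => v [i [j [lj ->]]].
have lt : (absz (j + M%:Z)%R < (M + M).+1)%N by lia.
by exists (i, Ordinal lt) => /=; congr (R i _); lia.
Qed.

(** What [A] may miss of the forward part lies in a finite segment, which is not hit. *)
Lemma hit_forward (s : int -> V) (A : set V) (m : int) :
  hit (forward_part s) -> (forall j, m <= j -> A (s j)) -> hit A.
Proof.
move=> hs sA; apply: contrapT => hA.
have := unhitU hA (@unhit_segment unit (fun=> s) `|m|%N); apply; apply: hitS hs.
move=> _ [j /= j0 <-]; have [/sA|mj] := boolP (m <= j); first by left.
by right; exists tt, j; split=> //; lia.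
Qed.

(** The new lines avoid all old forward parts, so forward parts stay within the old ones and remain
    unhit; only backward parts are diverted. With [E] reversed this also treats unhit backward
    parts. *)
Lemma infinitely_many_unhit (v0 : V) :
  (forall k A, ~ hit A -> exists s : 'I_k -> int -> V,
    disjoint_lines E s /\
    forall a, ~ hit (forward_part (s a)) /\ forall p, ~ A (s a p)) ->
  exists R : nat -> int -> V, disjoint_lines E R.
Proof.
move=> supply.
apply: (@infinitely_many_lines _ _ v0 (fun r => ~ hit (forward_part r))).
move=> k R m RE RG; pose M := m.+1.
pose fwd := [set v | exists i, forward_part (R i) v].
pose mid := [set v | exists i (j : int), - M%:Z <= j <= M%:Z /\ v = R i j].
have nfwd : ~ hit fwd by exact: hit_bigcup.
have nmid : ~ hit mid by exact: unhit_segment.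
have [s [sE sP]] := supply (k + k).+1 _ (unhitU nfwd nmid).
pose Wp := [set v | exists i (j : int), M%:Z <= j /\ v = R i j].
have Wpf : Wp `<=` fwd.
  by move=> _ [i [j [lj ->]]]; exists i, j => //=; move: lj; rewrite /M; lia.
(* No new line meets [Wp], so both closure conditions hold vacuously. *)
have sWp a p : ~ Wp (s a p) by move=> /Wpf h; apply: ((sP a).2 p); left.
exists M, Wp, (~` Wp), s; split=> //.
- by split=> // a; case: (sP a).
- split=> [v //|a p i j lj e]; apply: ((sP a).2 p); right.
  by exists i, j; split=> //; lia.
- split=> [i j lj|i j lj [i' [j' [lj' /(RE.1)[_]]]]]; first by exists i, j.
  by move: lj lj'; rewrite /M; lia.
- split=> [a p /sWp//|a p _ /sWp//|r rp _].
  have := unhitU nfwd (@unhit_segment unit (fun=> r) M).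
  apply: contra_not; apply: hitS => _ [j /= j0 <-].
  have [/rp/Wpf|mj] := boolP (M%:Z <= j); first by left.
  by right; exists tt, j; split=> //; lia.
Qed.

End Unhit.

(** * From an ultrafilter of fat properties to infinitely many lines *)

Section Ultra.
Variables (V : Type) (D : digraph V) (RR : nat -> set (digraph V)).
Variable U : set_system (digraph V).
Variables (v0 : V) (line : digraph V -> int -> V).
Hypotheses (RRvalid : valid_sequence D RR) (UU : UltraFilter U).
Hypothesis lineP : forall R, double_ray R -> line_of R (line R).
Hypothesis U_fat : forall P, U P -> forall N, exists n (g : nat -> digraph V),
  (forall i j, i < N -> j < N -> g i = g j -> i = j) /\
  forall i, i < N -> RR n (g i) /\ P (g i).
Hypothesis U_end : forall e, is_end D e -> ~ U [set R | forall T, tail R T -> e T].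
Local Open Scope ring_scope.

Definition hit (A : set V) : Prop := U [set R | vset R `&` A !=set0].

Lemma hitS A B : A `<=` B -> hit A -> hit B.
Proof. by move=> AB; rewrite /hit; apply: filterS => R [v [Rv /AB]]; exists v. Qed.

Lemma unhit A : ~ hit A -> U [set R | forall v, vset R v -> ~ A v].
Proof.
move=> hA; have [//|] := in_ultra_setVsetC [set R | vset R `&` A !=set0] UU.
by apply: filterS => R h v Rv Av; apply: h; exists v.
Qed.

(** Fatness would give two distinct members of one [RR n] through [v], but these are disjoint. *)
Lemma hit1 v : ~ hit [set v].
Proof.
move=> /U_fat/(_ 2)[n [g [ginj gP]]]; have [_ [_ triv]] := RRvalid n.
have [R0 [x [/= h0 xv]]] := gP 0%N isT; subst x.
have [R1 [x [/= h1 xv]]] := gP 1%N isT; subst x.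
have := ginj 0%N 1%N isT isT (triv _ _ R0 R1 _) => h.
by suff : 0%N = 1%N by []; apply: h; exists v.
Qed.

Lemma hit_bigcup (I : finType) (A : I -> set V) :
  (forall i, ~ hit (A i)) -> ~ hit [set v | exists i, A i v].
Proof.
move=> hA; rewrite /hit => hall.
have : U [set R | forall i, forall v, vset R v -> ~ A i v].
  by apply: filter_forall => i; apply: unhit.
move=> /(filterI hall)/filter_ex[R [[v [Rv [i Av]]] /(_ i v Rv)]]; exact.
Qed.

Lemma unhit_finite (X : set V) : finite_set X -> ~ hit X.
Proof.
move=> /(@finite_seqP {classic V})[s ->].
have h := @hit_bigcup 'I_(size s) (fun i => [set nth v0 s i]) (fun=> @hit1 _).
apply: contra_not h; apply: hitS => v /= vs.
have lt : (index (v : {classic V}) s < size s)%N by rewrite index_mem.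
by exists (Ordinal lt) => /=; rewrite (@nth_index {classic V}).
Qed.

Lemma U_double_ray : U [set R | subdigraph R D /\ double_ray R].
Proof.
have [//|/U_fat/(_ 1%N)[n [g [_ /(_ 0%N isT)[gR]]]]] :=
  in_ultra_setVsetC [set R | subdigraph R D /\ double_ray R] UU.
by case; have [_ [h _]] := RRvalid n; apply: h.
Qed.

Lemma supply_lines N P : U P -> exists s : 'I_N -> int -> V,
  disjoint_lines (edge D) s /\
  forall a, exists R, [/\ P R, line_of R (line R) & s a = line R].
Proof.
move=> /U_fat/(_ N)[n [g [ginj gP]]]; have [_ [RD triv]] := RRvalid n.
have gl (a : 'I_N) : line_of (g a) (line (g a)).
  by have [_ /lineP] := RD _ (gP a (ltn_ord a)).1.
exists (fun a => line (g a)); split; last first.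
  by move=> a; exists (g a); split=> //; case: (gP a).
split=> [a j b k e|a j].
  have [ai ae _] := gl a; have [_ be _] := gl b.
  have gab : g a = g b.
    apply: triv; [by case: (gP a)|by case: (gP b)|].
    by exists (line (g a) j); split; [rewrite ae; exists j|rewrite be e; exists k].
  have ab : a = b by apply/val_inj/(ginj _ _ (ltn_ord a) (ltn_ord b)).
  by subst b; split=> //; apply: ai.
have [_ _ lE] := gl a; have [[_ sub] _] := RD _ (gP a (ltn_ord a)).1.
by apply/sub/lE; exists j.
Qed.

(* The lines missing [X] and meeting both [A] and [B] start outside the set
   reachable from [A] and end inside it, entering it exactly once. *)
Lemma crossing_lines A B X : hit A -> hit B -> finite_set X ->
  (forall v, reach D X A v -> ~ B v) ->
  exists R : nat -> int -> V, disjoint_lines (edge D) R.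
Proof.
move=> hA hB finX sep; pose Z := reach D X A.
apply: (@infinitely_many_lines _ _ v0 (fun r => exists M : nat,
  (forall j : int, M%:Z <= j -> Z (r j)) /\
  (forall j : int, j <= - M%:Z -> ~ Z (r j)))).
(* Beyond [M] every old line has settled inside or outside [Z]; the summand [m] protects the
   segments to be fixed. *)
move=> k R m RE /choice[f fP]; pose M := ((\max_i f i) + m).+1.
have fM i : (f i <= M)%N by have := leq_bigmax i (F := f); rewrite /M; lia.
pose mid := [set v | exists i (j : int), - M%:Z <= j <= M%:Z /\ v = R i j].
have nmid : ~ hit mid by exact: (unhit_segment hitS hit1 hit_bigcup).
have UAB : U ([set R | vset R `&` A !=set0] `&` [set R | vset R `&` B !=set0]).
  by move: hA hB; rewrite /hit => hA hB; apply: filterI.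
have [s [sE sP]] := supply_lines (k + k).+1 (filterI UAB
  (filterI (unhit nmid) (unhit (unhit_finite finX)))).
have sR a p : ~ mid (s a p) /\ ~ X (s a p).
  have [S [[_ [h1 h2]] [_ Se _] ->]] := sP a.
  by split; [apply: h1|apply: h2]; rewrite Se; exists p.
(* Since the lines avoid [X], they cannot leave [Z]. *)
have sZ a p : Z (s a p) -> Z (s a (p + 1)).
  by move=> Zp; apply: reach_step Zp (sE.2 a p) (sR a _).2.
have sZle a p p' : p <= p' -> Z (s a p) -> Z (s a p').
  move=> pp' Zp; rewrite (_ : p' = p + (absz (p' - p)%R)%:Z); last lia.
  elim: (absz _) => [|n IH]; first by rewrite GRing.addr0.
  by rewrite (_ : p + n.+1%:Z = p + n%:Z + 1); [exact: sZ|lia].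
exists M, Z, (~` Z), s; split.
- by rewrite /M; lia.
- split=> // a; have [S [[[[x [Sx Ax]] [y [Sy By]]] _] [_ Se _] sS]] := sP a.
  move: Sx Sy; rewrite Se -sS => -[i _ ix] [j _ jy].
  (* The line is in [Z] from its vertex in [A] on, and outside [Z] up to its vertex in [B]. *)
  exists (`|i| + `|j|)%N; split=> l ll.
    apply: (@sZle a i l); first lia.
    by rewrite ix; apply: reach_start => //; rewrite -ix; apply: (sR a i).2.
  move=> Zl; apply: (sep y) By; rewrite -jy.
  by apply: (@sZle a l j) Zl; lia.
- split=> [v //|a p i j lj e]; apply: (sR a p).1.
  by exists i, j; split=> //; lia.
- by split=> i j lj; [apply: (fP i).1|apply: (fP i).2]; have := fM i; lia.
- by split=> [|a p nZ /sZ|r h1 h2]; [exact: sZ|exact: nZ|exists M].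
Qed.

Lemma infinitely_many_double_rays :
  exists R : nat -> int -> V, disjoint_lines (edge D) R.
Proof.
have [[A [B [X [hA hB fX sep]]]]|] := pselect (exists A B X,
    [/\ hit A, hit B, finite_set X & forall v, reach D X A v -> ~ B v]).
  exact: crossing_lines hA hB fX sep.
move=> nsep.
have hl A B : hit A -> hit B -> linked D A B.
  move=> hA hB X fX; apply: contrapT => h; apply: nsep.
  by exists A, B, X; split=> // v rv Bv; apply: h; exists v.
have [Uf|] := in_ultra_setVsetC [set R | hit (forward_part (line R))] UU; last first.
  move=> Uf; apply: (infinitely_many_unhit hitS hit1 hit_bigcup v0) => k A hA.
  have [s [sE sP]] := supply_lines k (filterI Uf (unhit hA)).
  exists s; split=> // a; have [R [[h1 h2] [_ Re _] ->]] := sP a.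
  by split=> // p; apply: h2; rewrite Re; exists p.
have [Ub|] := in_ultra_setVsetC [set R | hit (backward_part (line R))] UU; last first.
  move=> Ub.
  (* Reversing all edges turns backward parts into forward parts. *)
  suff [R RE] : exists R : nat -> int -> V, disjoint_lines (fun x y => edge D y x) R.
    by exists (fun i j => R i (- j)); apply: (disjoint_lines_opp RE).
  apply: (infinitely_many_unhit hitS hit1 hit_bigcup v0) => k A hA.
  have [s [sE sP]] := supply_lines k (filterI Ub (unhit hA)).
  exists (fun a j => s a (- j)); split; first exact: disjoint_lines_opp.
  move=> a; have [R [[h1 h2] [_ Re _] ->]] := sP a.
  by rewrite forward_part_opp; split=> // p; apply: h2; rewrite Re; exists (- p).
(* Now both parts of almost every double ray are hit. By [hl] all its tails are equivalent to one
   fixed tail [T0], which contradicts [U_end]. *)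
have UQ : U ([set R | hit (forward_part (line R))]
    `&` [set R | hit (backward_part (line R))]
    `&` [set R | subdigraph R D /\ double_ray R]).
  exact: filterI (filterI Uf Ub) U_double_ray.
have [R0 [[f0 _] [R0D /lineP R0l]]] := filter_ex UQ.
have [T0 [[T0R0 _] T0ray T0e]] := forward_ray R0l.
have sub_trans (G H K : digraph V) : subdigraph G H -> subdigraph H K -> subdigraph G K.
  by move=> [GH GHe] [HK HKe]; split=> [v /GH/HK|u v /GHe/HKe].
have T0D : rays_and_antirays D T0 by split; [exact: sub_trans R0D|left].
have hT0 : hit (vset T0) by rewrite T0e.
case: (@U_end [set Q | rays_and_antirays D Q /\ end_equiv D Q T0]); first by exists T0.
apply: filterS UQ => R [[fR bR] [RD /lineP Rl]] T RT.
have [Tray [m Tm]] := tail_contains Rl RT.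
have hT : hit (vset T).
  case: Tm => Tm; first exact: (hit_forward hitS hit1 hit_bigcup) fR Tm.
  move: bR; rewrite /= -forward_part_opp => bR.
  by apply: (hit_forward hitS hit1 hit_bigcup (m := - m)) bR _ => j mj; apply: Tm; lia.
have TD : subdigraph T D by apply: sub_trans RT.1 RD.
split=> //; split; apply: linked_infinitely_many;
  [exact: TD.1|exact: hl|exact: T0D.1.1|exact: hl].
Qed.

End Ultra.

(** * The ultrafilter given by non-concentration *)

Lemma injection_or_cover (T : Type) (t0 : T) (A : set T) (N : nat) :
  (exists g : nat -> T, (forall i j, i < N -> j < N -> g i = g j -> i = j) /\
    forall i, i < N -> A (g i)) \/
  exists f : nat -> T, A `<=` f @` `I_N.
Proof.
elim: N => [|N [[g [ginj gA]]|[f fA]]]; first by left; exists (fun=> t0).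
  have [[x Ax xg]|none] := pselect (exists2 x, A x & ~ (g @` `I_N) x).
    left; exists (fun i => if i < N then g i else x).
    split=> [i j|i _]; last by case: ifP => // /gA.
    rewrite !ltnS => iN jN; case: ltnP => iN'; case: ltnP => jN'.
    - exact: ginj.
    - by move=> e; case: xg; exists i.
    - by move=> e; case: xg; exists j.
    - lia.
  right; exists g => x Ax; apply: contrapT => xg; apply: none; exists x => //.
  by move=> [i /= iN gi]; apply: xg; exists i => //=; lia.
by right; exists f => x /fA[i /= iN fi]; exists i => //=; lia.
Qed.

(* The sets of double rays whose complement has bounded intersection with the
   [RR n], up to double rays concentrated in one of finitely many ends. *)
Definition cofat (V : Type) (D : digraph V) (RR : nat -> set (digraph V)) :
    set_system (digraph V) :=
  [set P | exists (N M : nat) (eps : 'I_M -> set (digraph V)),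
    (forall i, is_end D (eps i)) /\
    forall n, exists f : nat -> digraph V,
      [set R | [/\ RR n R, ~ P R & ~ exists i, forall T, tail R T -> eps i T]]
        `<=` f @` `I_N].

(** If the empty property were cofat, [RR] would concentrate. For an intersection, the bounds and
    the lists of ends of the two properties are added up. *)
Lemma cofat_proper (V : Type) (D : digraph V) (RR : nat -> set (digraph V)) :
  ~ concentrates_in_finitely_many_ends D RR -> ProperFilter (cofat D RR).
Proof.
move=> nconc; split.
  move=> [N [M [eps [epsE cover]]]]; apply: nconc; exists N, M, eps; split=> // n.
  have [f fP] := cover n; apply: card_le_trans (card_image_le f `I_N).
  by apply: subset_card_le => R [h1 h2]; apply: fP; split.
split.
- exists 0, 0, (fun=> set0); split=> [[]//|n].
  by exists (fun=> D) => R [_ []].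
- move=> P Q [N1 [M1 [e1 [e1E c1]]]] [N2 [M2 [e2 [e2E c2]]]].
  exists (N1 + N2), (M1 + M2), (fun i => match fintype.split i with
    inl j => e1 j | inr j => e2 j end).
  split=> [i|n]; first by case: fintype.split.
  have [f1 f1P] := c1 n; have [f2 f2P] := c2 n.
  exists (fun i => if i < N1 then f1 i else f2 (i - N1)) => R [RRn nPQ ne].
  have [PR|nP] := pselect (P R); last first.
    have [|i iN fi] := f1P R.
      split=> // -[i ei]; apply: ne; exists (lshift M2 i).
      by rewrite -[lshift M2 i]/(unsplit (inl i)) unsplitK.
    by exists i; rewrite /= ?iN //; move: iN => /=; lia.
  have [|i iN fi] := f2P R.
    split=> // [QR|[i ei]]; first exact: nPQ.
    apply: ne; exists (rshift M1 i).
    by rewrite -[rshift M1 i]/(unsplit (inr i)) unsplitK.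
  exists (N1 + i); first by move: iN => /=; lia.
  by rewrite ltnNge leq_addr /= addKn.
- move=> P Q PQ [N [M [e [eE c]]]]; exists N, M, e; split=> // n.
  by have [f fP] := c n; exists f => R [h1 h2 h3]; apply: fP; split=> // /PQ.
Qed.

Theorem theorem4p2 (V : Type) (D : digraph V) :
  (exists RR : nat -> set (digraph V),
     valid_sequence D RR /\ ~ concentrates_in_finitely_many_ends D RR) ->
  exists S : set (digraph V), infinite_set S /\ disjoint_double_rays D S.
Proof.
move=> [RR [RRvalid /cofat_proper/ultraFilterLemma[U [UU cofatU]]]].
have Ufat P : U P -> forall N, exists n (g : nat -> digraph V),
    (forall i j, i < N -> j < N -> g i = g j -> i = j) /\
    forall i, i < N -> RR n (g i) /\ P (g i).
  move=> UP N; apply: contrapT => nfat.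
  suff UnP : U (~` P).
    by apply: (filter_not_empty U); rewrite -(setICr P); apply: filterI.
  (* If [P] is not fat, at most [N] members of each [RR n] have it, so its complement is cofat
     without using any end. *)
  apply: cofatU; exists N, 0, (fun=> set0); split=> [[]//|n].
  have [[g [ginj gP]]|[f fP]] := injection_or_cover D [set R | RR n R /\ P R] N.
    by case: nfat; exists n, g.
  by exists f => R [RRn /contrapT PR _]; apply: fP.
(* Fatness of the full property yields a double ray, whose vertex [v0] serves as default value. *)
have [n [g [_ /(_ 0 isT)[g0 _]]]] := Ufat _ filterT 1.
have [_ [/(_ _ g0)[_ [/infinite_setN0[v0 _] _ _]] _]] := RRvalid n.
have /choice[line lineP] : forall R : digraph V,
    exists s : int -> V, double_ray R -> line_of R s.
  move=> R; have [/double_ray_line[s Rs]|] := pselect (double_ray R).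
    by exists s.
  by exists (fun=> v0).
have Uend e : is_end D e -> ~ U [set R | forall T, tail R T -> e T].
  move=> De Ue; suff Une : U (~` [set R | forall T, tail R T -> e T]).
    apply: (filter_not_empty U).
    by rewrite -(setICr [set R | forall T, tail R T -> e T]); apply: filterI.
  (* The double rays outside this complement have all tails in [e], so the single end [e] absorbs
     them and no exceptions remain. *)
  apply: cofatU; exists 0, 1, (fun=> e); split=> // k.
  by exists (fun=> D) => R [_ /contrapT h []]; exists ord0.
have [R RD] := infinitely_many_double_rays v0 RRvalid UU lineP Ufat Uend.
exact: disjoint_lines_double_rays RD.
Qed.
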